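(* Let $q$ be an odd prime power, $p=\operatorname{char}\mathbb F_q$, and $d\ge1$. Suppose that $$p\mid d+2\qquad\text{and}\qquad\bigl(d\text{ is odd or }q\equiv1\pmod4\bigr).$$ Let $1\le k\le d+1$, and put $\ell=\min(k,d+2-k)$. If $\ell<p$, then the standard quadratic space $(\mathbb F_q^d,\ Q(x)=x_1^2+\cdots+x_d^2)$ contains an $\ell$-distance set of size $\binom{d+2}{k}$. In particular, if $d\ge2$, then taking $k=2$ gives a two-distance set of size $\binom{d+2}{2}$, namely the set of edge midpoints $\{(P_i+P_j)/2: 0\le i<j\le d+1\}$ of a $(d+2)$-point equilateral set $\{P_0,\ldots,P_{d+1}\}\subset\mathbb F_q^d$.
   Context: A set $S\subseteq\mathbb F_q^d$ is an $s$-distance set if $Q(x-y)$, over distinct $x,y\in S$, takes exactly $s$ values; a two-distance set is the case $s=2$. Points $P_0,\ldots,P_{d+1}$ form an equilateral set (with nonzero common squared distance) if there is $\Delta\in\mathbb F_q^*$ with $Q(P_i-P_j)=\Delta$ for all $i\ne j$. *)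

(* Defs.v *)
From HB Require Import structures.
From mathcomp Require Import all_boot all_order all_algebra.

Set Implicit Arguments.
Unset Strict Implicit.
Unset Printing Implicit Defensive.

Import GRing.Theory.
Local Open Scope ring_scope.

Definition sqform (F : finFieldType) (d : nat) (x : 'rV[F]_d) : F :=
  \sum_(i < d) x 0 i ^+ 2.

Definition distances (F : finFieldType) (d : nat) (S : {set 'rV[F]_d}) :
    {set F} :=
  [set sqform (x - y) | x in S, y in S & x != y].

Definition distance_set (F : finFieldType) (d s : nat) (S : {set 'rV[F]_d}) :
    Prop :=
  #|distances S| = s.

(* The points are automatically distinct, since sqform 0 = 0 and D != 0. *)
Definition equilateral (F : finFieldType) (d n : nat) (P : 'I_n -> 'rV[F]_d) :
    Prop :=
  exists2 D : F, D != 0 & forall i j : 'I_n, i != j -> sqform (P i - P j) = D.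

Definition edge_midpoints (F : finFieldType) (d n : nat)
    (P : 'I_n -> 'rV[F]_d) : {set 'rV[F]_d} :=
  [set 2%:R^-1 *: (P ij.1 + P ij.2) | ij : 'I_n * 'I_n & (ij.1 < ij.2)%N].

(* Main.v *)
(** As p | d+2, the all-ones vector of F^(d+2) is isotropic, and the quotient
    of its orthogonal complement by its span is a d-dimensional quadratic space
    in which the images of the differences e_i - e_j of basis vectors all have
    squared length 2. When some (d+1) x (d+1) matrix T satisfies T T^T = -1,
    this quotient is standard up to the factor -1. Such a T is the scalar matrix
    sqrt(-1) when q = 1 mod 4, and [a b; b -a] with scalar blocks satisfying
    a^2 + b^2 = -1 when d is odd. For the resulting equilateral points with
    common squared distance D, the sums over two k-subsets I and J differ by a
    vector of squared length D |I \ J|, so the k-subset sums are pairwise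
    distinct and realize the distances D m for 1 <= m <= min(k, d+2-k), which
    are distinct as long as min(k, d+2-k) < p. *)
Require Import Defs.
From mathcomp Require Import all_boot all_order all_algebra all_field.
From mathcomp Require Import ring.

Set Implicit Arguments.
Unset Strict Implicit.
Unset Printing Implicit Defensive.

Section Equilateral.

Import GRing.Theory.
Local Open Scope ring_scope.

(** * Dot products and squared distances *)

Definition dotr (R : nzRingType) (d : nat) (x y : 'rV[R]_d) : R :=
  \sum_(i < d) x 0 i * y 0 i.

Section DotProduct.

Variables (R : comNzRingType) (d : nat).
Implicit Types (x y z : 'rV[R]_d).

Lemma dotrC x y : dotr x y = dotr y x.
Proof. by apply: eq_bigr => i _; rewrite mulrC. Qed.

Lemma dotrDl x y z : dotr (x + y) z = dotr x z + dotr y z.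
Proof. by rewrite -big_split; apply: eq_bigr => i _; rewrite mxE mulrDl. Qed.

Lemma dotrZl a x z : dotr (a *: x) z = a * dotr x z.
Proof. by rewrite mulr_sumr; apply: eq_bigr => i _; rewrite mxE mulrA. Qed.

Lemma dotrDr x y z : dotr z (x + y) = dotr z x + dotr z y.
Proof. by rewrite !(dotrC z) dotrDl. Qed.

Lemma dotrZr a x z : dotr z (a *: x) = a * dotr z x.
Proof. by rewrite !(dotrC z) dotrZl. Qed.

Lemma dotr_suml (I : Type) (r : seq I) (P : pred I) (f : I -> 'rV[R]_d) z :
  dotr (\sum_(i <- r | P i) f i) z = \sum_(i <- r | P i) dotr (f i) z.
Proof.
elim/big_rec2: _ => [|i a b _ <-]; last by rewrite dotrDl.
by apply: big1 => i _; rewrite mxE mul0r.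
Qed.

Lemma dotr_sumr (I : Type) (r : seq I) (P : pred I) (f : I -> 'rV[R]_d) z :
  dotr z (\sum_(i <- r | P i) f i) = \sum_(i <- r | P i) dotr z (f i).
Proof. by rewrite dotrC dotr_suml; apply: eq_bigr => i _; rewrite dotrC. Qed.

End DotProduct.

Section SquaredDistances.

Variables (F : finFieldType) (d : nat).
Implicit Types (x y : 'rV[F]_d).

Lemma sqform_dotr x : sqform x = dotr x x.
Proof. by apply: eq_bigr => i _; rewrite expr2. Qed.

Lemma sqformD x y : sqform (x + y) = sqform x + 2%:R * dotr x y + sqform y.
Proof. rewrite !sqform_dotr dotrDl !dotrDr (dotrC y x); ring. Qed.

Lemma sqformZ a x : sqform (a *: x) = a ^+ 2 * sqform x.
Proof. by rewrite !sqform_dotr dotrZl dotrZr mulrA. Qed.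

Lemma sqformB x y : sqform (x - y) = sqform x - 2%:R * dotr x y + sqform y.
Proof. rewrite -scaleN1r sqformD sqformZ dotrZr; ring. Qed.

Lemma sqformC x y : sqform (x - y) = sqform (y - x).
Proof. by rewrite -opprB -scaleN1r sqformZ sqrrN expr1n mul1r. Qed.

(* Polarization gives 2 <P_i, P_j> = Q(P_i) + Q(P_j) - D (1 - [i = j]); all
   terms but D [i = j] cancel because the weights sum to zero. *)
Lemma sqform_equilateral_sum n (P : 'I_n -> 'rV[F]_d) D (c : 'I_n -> F) :
  (forall i j, i != j -> sqform (P i - P j) = D) -> \sum_i c i = 0 ->
  2%:R * sqform (\sum_i c i *: P i) = D * \sum_i c i ^+ 2.
Proof.
move=> PD c0.
have dotP i j : 2%:R * dotr (P i) (P j)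
    = sqform (P i) + sqform (P j) - D + D * (i == j)%:R.
  have [<-|ij] := eqVneq i j; first by rewrite -sqform_dotr /=; ring.
  by rewrite -(PD i j ij) sqformB /=; ring.
rewrite sqform_dotr dotr_suml [LHS]mulr_sumr.
transitivity (\sum_i c i * (\sum_j c j * (2%:R * dotr (P i) (P j)))).
  apply: eq_bigr => i _; rewrite dotrZl dotr_sumr !mulr_sumr.
  by apply: eq_bigr => j _; rewrite dotrZr; ring.
(* The inner sum over [j] of [c j * sqform (P j)] does not depend on [i], so it is killed in turn by
   the outer sum of the weights. *)
transitivity (\sum_i (c i * \sum_j c j * sqform (P j) + D * c i ^+ 2)).
  apply: eq_bigr => i _.
  have -> : D * c i ^+ 2 = c i * (c i * D) by ring.
  rewrite -mulrDr; congr (_ * _).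
  have -> : c i * D = \sum_j c j * (D * (i == j)%:R).
    rewrite (bigD1 i) //= eqxx mulr1 big1 ?addr0 // => j /negbTE.
    by rewrite eq_sym => ->; rewrite !mulr0.
  have z : \sum_j c j * (sqform (P i) - D) = 0 by rewrite -mulr_suml c0 mul0r.
  rewrite -[RHS]add0r -[X in X + _]z -!big_split /=.
  by apply: eq_bigr => j _; rewrite dotP; ring.
by rewrite big_split /= -mulr_suml c0 mul0r add0r mulr_sumr.
Qed.

End SquaredDistances.

(** * Sums over the k-subsets of an equilateral set *)

Section SubsetSums.

Variables (F : finFieldType) (d n : nat) (P : 'I_n -> 'rV[F]_d) (D e : F).
Hypotheses (two_neq0 : 2%:R != 0 :> F) (D_neq0 : D != 0) (e_neq0 : e != 0).
Hypothesis PD : forall i j, i != j -> sqform (P i - P j) = D.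
Implicit Types (I J : {set 'I_n}) (k l m : nat).

(** The scale [e] lets one construction cover plain sums ([e = 1]) and edge midpoints
    ([e = 1/2]). *)
Definition subset_sum I : 'rV[F]_d := e *: \sum_(i in I) P i.

Definition subset_sums k : {set 'rV[F]_d} :=
  [set subset_sum I | I : {set 'I_n} & #|I| == k].

(** The difference of the two indicator functions has weights summing to zero, and its squares add
    up to the size of the symmetric difference, which is twice that of [I :\: J]. *)
Lemma sqform_subset_sumB I J : #|I| = #|J| ->
  sqform (subset_sum I - subset_sum J) = e ^+ 2 * D * #|I :\: J|%:R.
Proof.
move=> IJ.
have cDJ : #|I :\: J| = #|J :\: I|.
  by apply/eqP; rewrite -(eqn_add2l #|I :&: J|) cardsID setIC cardsID IJ.
pose c i : F := (i \in I)%:R - (i \in J)%:R.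
have sumA (A : {set 'I_n}) : \sum_i (i \in A)%:R = #|A|%:R :> F.
  rewrite -sum1_card natr_sum [RHS]big_mkcond /=.
  by apply: eq_bigr => i _; case: ifP.
have c0 : \sum_i c i = 0 by rewrite sumrB !sumA IJ subrr.
have c2 : \sum_i c i ^+ 2 = 2%:R * #|I :\: J|%:R.
  transitivity (\sum_i ((i \in I :\: J)%:R + (i \in J :\: I)%:R : F)).
    apply: eq_bigr => i _; rewrite /c !inE.
    by case: (i \in I); case: (i \in J) => /=; ring.
  by rewrite big_split /= !sumA -cDJ; ring.
have -> : subset_sum I - subset_sum J = e *: \sum_i c i *: P i.
  rewrite -scalerBr; congr (_ *: _).
  rewrite !(big_mkcond (fun i => i \in _)) /= -sumrB.
  apply: eq_bigr => i _; rewrite scalerBl.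
  by case: (i \in I); case: (i \in J); rewrite ?scale0r ?scale1r.
rewrite sqformZ -mulrA; congr (_ * _).
apply: (mulfI two_neq0); rewrite (sqform_equilateral_sum PD c0) c2; ring.
Qed.

Variable p : nat.
Hypothesis hp : p \in [pchar F].

Lemma natf_neq0_lt_pchar m : (0 < m < p)%N -> m%:R != 0 :> F.
Proof.
move=> /andP[m0 mp]; rewrite -(dvdn_pcharf hp).
by apply/negP => /(dvdn_leq m0); rewrite leqNgt mp.
Qed.

Lemma natf_inj_lt_pchar l m :
  (l < p)%N -> (m < p)%N -> l%:R = m%:R :> F -> l = m.
Proof.
wlog le_lm : l m / (l <= m)%N => [wl lp mp lm|lp mp lm].
  by have [/wl|/ltnW/wl] := leqP l m; [apply | move=> ->].
apply/eqP; rewrite eqn_leq le_lm /= -subn_eq0.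
have [//|] := posnP (m - l) => ml.
have /negP[] : (m - l)%:R != 0 :> F.
  by rewrite natf_neq0_lt_pchar // ml (leq_ltn_trans (leq_subr _ _)).
by rewrite natrB // lm subrr.
Qed.

Lemma card_setD_le_minn k I J :
  #|I| = k -> #|J| = k -> (#|I :\: J| <= minn k (n - k))%N.
Proof.
move=> Ik Jk; rewrite leq_min -{1}Ik subset_leq_card ?subsetDl //=.
have -> : (n - k)%N = #|~: J| by rewrite cardsCs setCK card_ord Jk.
by rewrite subset_leq_card // setDE subsetIr.
Qed.

Lemma exists_card_subset (A : {set 'I_n}) m :
  (m <= #|A|)%N -> exists2 B : {set 'I_n}, B \subset A & #|B| = m.
Proof.
rewrite -bin_gt0 -cards_draws card_gt0 => /set0Pn[B].
by rewrite inE => /andP[BA /eqP Bm]; exists B.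
Qed.

(** Exchange [m] elements of a k-subset for [m] elements of its complement. *)
Lemma exists_card_setD k m : (m <= minn k (n - k))%N -> (k <= n)%N ->
  exists I J, [/\ #|I| = k, #|J| = k & #|I :\: J| = m].
Proof.
rewrite leq_min => /andP[mk mnk] kn.
have [|I _ Ik] := @exists_card_subset setT k; first by rewrite cardsT card_ord.
have [|A AI Am] := @exists_card_subset I m; first by rewrite Ik.
have [|B BI Bm] := @exists_card_subset (~: I) m.
  by rewrite cardsCs setCK card_ord Ik.
exists I, ((I :\: A) :|: B).
have BI0 : [disjoint I & B] by rewrite disjoints_subset -setCS setCK.
have IDB : I :\: B = I by apply/setDidPl.
split=> //; last first.
  by rewrite setDUr IDB setDDr setDv set0U setIAC setIid (setIidPr AI).
rewrite cardsU cardsD (setIidPr AI) Ik Am Bm.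
have -> : (I :\: A) :&: B = set0.
  apply: disjoint_setI0; apply: disjointWl BI0; exact: subsetDl.
by rewrite cards0 subn0 subnK.
Qed.

Section LevelSet.

Variable k : nat.
Hypotheses (kn : (k <= n)%N) (kp : (minn k (n - k) < p)%N).

(** Equal sums have squared distance zero, so the size of [I :\: J] vanishes in [F]; being below
    [p], it is zero as a natural number. *)
Lemma subset_sum_inj :
  {in [set I : {set 'I_n} | #|I| == k] &, injective subset_sum}.
Proof.
move=> I J; rewrite !inE => /eqP Ik /eqP Jk IJ.
have IJk : #|I| = #|J| by rewrite Ik.
have := sqform_subset_sumB IJk; rewrite IJ subrr.
rewrite sqform_dotr -[X in dotr X _](scale0r 0) dotrZl mul0r => /esym/eqP.
rewrite !mulf_eq0 (negbTE D_neq0) (negbTE e_neq0) /=.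
have [IJ0 _|IJ0] := posnP #|I :\: J|; last first.
  rewrite (negbTE (natf_neq0_lt_pchar _)) // IJ0.
  exact: leq_ltn_trans (card_setD_le_minn Ik Jk) kp.
apply/eqP; rewrite eqEcard IJk leqnn andbT -setD_eq0.
by rewrite -cards_eq0 IJ0.
Qed.

Lemma card_subset_sums : #|subset_sums k| = 'C(n, k).
Proof.
by rewrite card_in_imset ?card_draws ?card_ord //; exact: subset_sum_inj.
Qed.

Lemma distances_subset_sums :
  distances (subset_sums k)
    = [set e ^+ 2 * D * m.+1%:R | m : 'I_(minn k (n - k))].
Proof.
apply/setP => a; apply/imset2P/imsetP => [[x y]|[m _ ->]].
  move=> /imsetP[I]; rewrite inE => /eqP Ik ->.
  rewrite inE => /andP[/imsetP[J]]; rewrite inE => /eqP Jk -> IJ ->.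
  have IJ0 : (0 < #|I :\: J|)%N.
    rewrite card_gt0 setD_eq0; apply: contra IJ => IJ.
    suff -> : I = J by [].
    by apply/eqP; rewrite eqEcard IJ Ik Jk leqnn.
  have lt : (#|I :\: J|.-1 < minn k (n - k))%N.
    by rewrite prednK // card_setD_le_minn.
  exists (Ordinal lt) => //=.
  by rewrite sqform_subset_sumB ?Ik ?Jk // prednK.
have [I [J [Ik Jk IJm]]] := exists_card_setD (ltn_ord m) kn.
exists (subset_sum I) (subset_sum J).
- by apply: imset_f; rewrite inE Ik.
- rewrite inE imset_f ?inE ?Jk //=; apply/eqP => /subset_sum_inj.
  rewrite !inE Ik Jk => /(_ (eqxx _) (eqxx _)) IJ.
  by move: IJm; rewrite IJ setDv cards0.
- by rewrite sqform_subset_sumB ?Ik ?Jk // IJm.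
Qed.

Lemma distance_set_subset_sums :
  distance_set (minn k (n - k)) (subset_sums k).
Proof.
rewrite /distance_set distances_subset_sums card_imset ?card_ord //.
move=> i j /mulfI; rewrite mulf_neq0 ?expf_neq0 // => /(_ isT).
move=> /natf_inj_lt_pchar h; apply: val_inj; apply: succn_inj; apply: h.
  exact: leq_ltn_trans (ltn_ord i) kp.
exact: leq_ltn_trans (ltn_ord j) kp.
Qed.

End LevelSet.

End SubsetSums.

Lemma edge_midpointsE (F : finFieldType) d n (P : 'I_n -> 'rV[F]_d) :
  edge_midpoints P = subset_sums P 2%:R^-1 2.
Proof.
apply/setP => x; apply/imsetP/imsetP => [[[i j]]|[I]].
  rewrite inE /= => ij ->; exists [set i; j].
    by rewrite inE cards2 neq_ltn ij.
  by rewrite /subset_sum big_setU1 ?big_set1 // inE neq_ltn ij.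
rewrite inE => /cards2P[i [j [ij ->]]] ->.
wlog lt_ij : i j ij / (i < j)%N => [wl|].
  have [/wl|/wl|/val_inj/eqP] := ltngtP i j; last by rewrite (negbTE ij).
    exact.
  by rewrite setUC; apply; rewrite eq_sym.
exists (i, j); rewrite ?inE //.
by rewrite /subset_sum big_setU1 ?big_set1 // inE.
Qed.

(** * Square roots and sums of squares equal to -1, and the matrices built from them *)

Section AntiIsometry.

Variable F : finFieldType.

Lemma odd_card_two_neq0 : odd #|F| -> 2%:R != 0 :> F.
Proof.
apply: contraL => two0; have ch2 : 2%N \in [pchar F] by rewrite inE.
have := card_pprimeChar ch2; set n := (X in (_ ^ X)%N) => cardF.
have : (1 < #|F|)%N := finNzRing_gt1 F.
by rewrite cardF; case: n {cardF} => // n _; rewrite expnS oddM.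
Qed.

(** Pigeonhole: the fibres of squaring have at most two elements, so the set [A] of squares and its
    reflection -1 - [A] each fill at least half of [F]. If they were disjoint, the order of [F]
    would be even. *)
Lemma sum_two_squares_N1 : odd #|F| -> exists a b : F, a ^+ 2 + b ^+ 2 = -1.
Proof.
move=> oddF; pose A : {set F} := [set a ^+ 2 | a : F].
have card_le : (#|F| <= #|A| * 2)%N.
  rewrite -[leqLHS]sum1_card (partition_big_imset (fun a : F => a ^+ 2)) /=.
  rewrite -sum_nat_const; apply: leq_sum => _ /imsetP[a _ ->].
  rewrite sum1_card; apply: leq_trans (_ : #|[set a; - a]| <= 2)%N.
    by apply: subset_leq_card; apply/subsetP => b; rewrite !inE -eqf_sqr.
  by rewrite cards2; case: (_ != _).
pose B : {set F} := [set -1 - a | a in A].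
have cardB : #|B| = #|A| by apply: card_imset => a b /addrI/oppr_inj.
have [|[c]] := set_0Vmem (A :&: B).
  move=> AB0; have := cardsUI A B; rewrite AB0 cards0 addn0 cardB => cU.
  have := max_card (A :|: B); rewrite cU addnn -muln2 => le.
  have : #|F| = (#|A| * 2)%N by apply/eqP; rewrite eqn_leq card_le.
  by move=> eqF; move: oddF; rewrite eqF muln2 odd_double.
rewrite inE => /andP[/imsetP[a _ ->] /imsetP[_ /imsetP[b _ ->] ab]].
by exists a, b; rewrite ab subrK.
Qed.

Lemma sqrtN1 : (#|F| = 1 %[mod 4])%N -> exists a : F, a ^+ 2 = -1.
Proof.
move=> card4; pose n := (#|F| %/ 4)%N.
have F_gt1 : (1 < #|F|)%N := finNzRing_gt1 F.
have oF : #|F| = (n.*2.*2).+1.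
  by rewrite [LHS](divn_eq _ 4) card4 -!muln2 -mulnA addn1.
have n_gt0 : (0 < n)%N.
  by rewrite lt0n; apply: contraTneq F_gt1 => n0; rewrite oF n0.
(* Its degree 2n + 1 is less than the order 4n + 1, so some nonzero [a] has a^(2n) != 1. Since
   a^(4n) = 1, it follows that a^(2n) = -1. *)
pose f : {poly F} := ('X^(n.*2) - 1%:P) * 'X.
have szf : size f = n.*2.+2.
  have szXn : size ('X^(n.*2) - 1%:P : {poly F}) = n.*2.+1.
    by rewrite size_XnsubC ?double_gt0.
  by rewrite size_mulX ?szXn // -size_poly_eq0 szXn.
have [a af] : exists a : F, ~~ root f a.
  apply/existsP; rewrite -negb_forall; apply/negP => /forallP allf.
  have := @max_poly_roots _ f (enum F) _ _ (enum_uniq F).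
  rewrite -size_poly_eq0 szf => /(_ isT).
  have -> : all (root f) (enum F) by apply/allP => a _.
  rewrite -cardE oF !ltnS leq_double -addnn -[leqRHS]addn0 leq_add2l.
  by rewrite leqNgt n_gt0 => /(_ isT).
move: af; rewrite /root !hornerE mulf_eq0 negb_or => /andP[an1 a0].
exists (a ^+ n).
have /eqP := expf_card a; rewrite oF exprS -[eqbRHS]mulr1.
rewrite (inj_eq (mulfI a0)) -muln2 exprM sqrf_eq1 => /orP[|/eqP <-].
  by rewrite -subr_eq0 (negbTE an1).
by rewrite -exprM muln2.
Qed.

Lemma anti_isometry_double m : odd #|F| ->
  exists T : 'M[F]_(m + m), T *m T^T = - 1%:M.
Proof.
move=> /sum_two_squares_N1[a [b ab]].
exists (block_mx a%:M b%:M b%:M (- a)%:M).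
rewrite tr_block_mx !tr_scalar_mx mulmx_block -!scalar_mxM -!raddfD /=.
have -> : a * b + b * - a = 0 by ring.
have -> : b * a + - a * b = 0 by ring.
have -> : a * a + b * b = -1 by rewrite -ab; ring.
have -> : b * b + - a * - a = -1 by rewrite -ab; ring.
by rewrite scalar_mx_block opp_block_mx oppr0 !raddfN !raddf0.
Qed.

Lemma anti_isometry_sqrtN1 n (a : F) : a ^+ 2 = -1 ->
  exists T : 'M[F]_n, T *m T^T = - 1%:M.
Proof.
by move=> a2; exists a%:M; rewrite tr_scalar_mx -scalar_mxM -expr2 a2 raddfN.
Qed.

(** * Equilateral sets of d + 2 points *)

Lemma mul_rows_anti_isometry d (T : 'M[F]_(1 + d)) : T *m T^T = - 1%:M ->
  forall i j, T i 0 * T j 0 + dotr (row i (rsubmx T)) (row j (rsubmx T))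
    = - (i == j)%:R.
Proof.
move=> TT i j; have := congr1 (fun M : 'M_(1 + d) => M i j) TT.
rewrite !mxE big_split_ord big_ord1 !mxE => <-.
have e0 : lshift d 0 = 0 :> 'I_(1 + d) by apply: val_inj.
rewrite e0; congr (_ + _).
by apply: eq_bigr => k _; rewrite !mxE.
Qed.

(* P is the image of the standard basis of F^(d+2) under 1 (+) T, which
   multiplies dot products by -1 when the target carries the form
   -x_0^2 + x_1^2 + ... + x_(d+1)^2, followed by the projection that divides out
   the image of the all-ones vector. Its coefficients have denominator A - 1,
   where A is the sum of the first column of T; if A = 1 we use -T instead. *)
Lemma equilateral_of_anti_isometry d (T : 'M[F]_(1 + d)) :
  2%:R != 0 :> F -> d.+2%:R = 0 :> F -> T *m T^T = - 1%:M ->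
  exists P : 'I_d.+2 -> 'rV[F]_d, equilateral P.
Proof.
move=> two_neq0 d2 TT.
wlog A1 : T TT / \sum_i T i 0 != 1 => [wl|].
  have [A1|] := eqVneq (\sum_i T i 0) 1; last exact: wl.
  apply: (wl (- T)); first by rewrite linearN mulmxN mulNmx opprK.
  rewrite (eq_bigr (fun i => - T i 0)) => [|i _]; last by rewrite mxE.
  by rewrite sumrN A1 eq_sym -addr_eq0.
have := mul_rows_anti_isometry TT.
set A := \sum_i T i 0 in A1 *; set w := fun i => row i (rsubmx T) => dotw.
set al := fun i => T i 0 in dotw.
pose w0 := \sum_i w i; pose u := (A - 1)^-1 *: w0.
have dotww0 i : dotr (w i) w0 = -1 - al i * A.
  rewrite dotr_sumr mulr_sumr; apply/eqP; rewrite eq_sym subr_eq -big_split /=.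
  rewrite (eq_bigr (fun j => - (i == j)%:R)) => [|j _]; last first.
    by rewrite addrC dotw.
  rewrite sumrN (bigD1 i) //= eqxx big1 ?addr0 // => j.
  by rewrite eq_sym => /negbTE->.
(* The d + 1 terms -1 add up to 1 because d + 2 vanishes in [F]. *)
have sqw0 : sqform w0 = 1 - A ^+ 2.
  rewrite sqform_dotr {1}/w0 dotr_suml (eq_bigr _ (fun i _ => dotww0 i)) sumrB.
  rewrite -mulr_suml sumr_const card_ord -expr2; congr (_ - _).
  by rewrite mulNrn -[RHS]subr0 -d2 [in RHS]mulrS; ring.
have sqw i : sqform (w i) = -1 - al i ^+ 2.
  by rewrite sqform_dotr -(addKr (al i * al i) (dotr _ _)) dotw eqxx /=; ring.
have squ : sqform u = - (1 + A) / (A - 1).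
  by rewrite sqformZ sqw0; field; rewrite subr_eq0.
have dotwu i : dotr (w i) u = (-1 - al i * A) / (A - 1).
  by rewrite dotrZr dotww0 mulrC.
(* The basis vectors go to (1, 0, 0) and (0, [al j], [w j]), the all-ones vector to (1, [A], [w0]).
   From each image, the multiple of the latter is subtracted that makes the first two coordinates
   equal; these then cancel in the form, and [P] keeps the remaining d coordinates. *)
pose P (i : 'I_d.+2) := if unlift ord0 i is Some j then w j - al j *: u else u.
have P0 j : sqform (P (lift ord0 j) - P ord0) = - 2%:R.
  rewrite /P liftK unlift_none.
  have -> : w j - al j *: u - u = w j - (al j + 1) *: u.
    by rewrite scalerDl scale1r opprD addrA.
  rewrite sqformB sqw sqformZ squ dotrZr dotwu.
  by field; rewrite subr_eq0.
exists P, (- 2%:R) => [|i j]; first by rewrite oppr_eq0.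
case: (unliftP ord0 i) => [i'|] ->; case: (unliftP ord0 j) => [j'|] -> //.
- move=> ij; rewrite /P !liftK.
  have nij : i' != j' by apply: contraNneq ij => ->.
  have -> : w i' - al i' *: u - (w j' - al j' *: u)
      = (w i' - w j') - (al i' - al j') *: u.
    by rewrite scalerBl [in LHS]opprD addrACA -opprD.
  have sqB : sqform (w i' - w j') = -2%:R - (al i' - al j') ^+ 2.
    have dij : dotr (w i') (w j') = - (al i' * al j').
      by apply/eqP; rewrite -addr_eq0 addrC dotw (negbTE nij) oppr0.
    by rewrite sqformB !sqw dij; ring.
  rewrite sqformB sqB sqformZ squ dotrZr -scaleN1r dotrDl dotrZl !dotwu.
  by field; rewrite subr_eq0.
- by rewrite sqformC P0.
Qed.

Lemma exists_equilateral d : odd #|F| -> d.+2%:R = 0 :> F ->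
  odd d \/ (#|F| = 1 %[mod 4])%N ->
  exists P : 'I_d.+2 -> 'rV[F]_d, equilateral P.
Proof.
move=> oddF d2 hd; have two_neq0 := odd_card_two_neq0 oddF.
suff [T] : exists T : 'M[F]_(1 + d), T *m T^T = - 1%:M.
  exact: equilateral_of_anti_isometry.
case: hd => [odd_d|/sqrtN1[a]]; last exact: anti_isometry_sqrtN1.
(* For odd d the size 1 + d is even, as the block construction requires. *)
have -> : (1 + d = uphalf d + uphalf d)%N.
  by rewrite addnn -[in LHS](odd_double_half d) uphalf_half odd_d.
exact: anti_isometry_double.
Qed.

End AntiIsometry.

End Equilateral.

Theorem theorem4p6 (F : finFieldType) (q p d : nat)
    (hq : #|F| = q) (hodd : odd q) (hp : p \in [pchar F]%R) (hd : 1 <= d)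
    (hpd : p %| d + 2) (hdq : odd d \/ q = 1 %[mod 4]) :
  (forall k : nat, 1 <= k <= d + 1 -> minn k (d + 2 - k) < p ->
     exists S : {set 'rV[F]_d},
       #|S| = 'C(d + 2, k) /\ distance_set (minn k (d + 2 - k)) S)
  /\
  (2 <= d ->
     exists P : 'I_(d + 2) -> 'rV[F]_d,
       [/\ equilateral P,
           #|edge_midpoints P| = 'C(d + 2, 2)
         & distance_set 2 (edge_midpoints P)]).
Proof.
subst q; have two_neq0 := odd_card_two_neq0 hodd.
have d2 : (d.+2%:R = 0 :> F)%R.
  by apply/eqP; rewrite -(GRing.dvdn_pcharf hp) -addn2.
have [P eqP] := exists_equilateral hodd d2 hdq; have [D D_neq0 PD] := eqP.
rewrite !addn2 addn1; split=> [k /andP[_ kd] kp|d_ge2].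
  have one_neq0 : (1 != 0 :> F)%R := GRing.oner_neq0.
  exists (subset_sums P 1%R k); split.
    exact (card_subset_sums two_neq0 D_neq0 one_neq0 PD hp kp).
  have kn : k <= d.+2 := leqW kd.
  exact (distance_set_subset_sums two_neq0 D_neq0 one_neq0 PD hp kn kp).
have min2 : minn 2 (d.+2 - 2) = 2 by apply/minn_idPl; rewrite subn2.
(* Odd characteristic gives the bound min(k, d + 2 - k) < p at k = 2. *)
have p_gt2 : 2 < p.
  rewrite ltn_neqAle (prime_gt1 (GRing.pcharf_prime hp)) andbT.
  by apply: contraNneq two_neq0 => ->; rewrite -(GRing.dvdn_pcharf hp).
have half_neq0 : (2%:R^-1 != 0 :> F)%R by rewrite GRing.invr_eq0.
have min2p : minn 2 (d.+2 - 2) < p by rewrite min2.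
exists P; rewrite edge_midpointsE; split=> //.
  exact (card_subset_sums two_neq0 D_neq0 half_neq0 PD hp min2p).
rewrite -[X in distance_set X]min2.
have kn : 2 <= d.+2 by [].
exact (distance_set_subset_sums two_neq0 D_neq0 half_neq0 PD hp kn min2p).
Qed.
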